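(* Let $c\ge 2$, and let $G=\langle a_1,\dots,a_n\mid r_1,\dots,r_m\rangle_{\mathcal N_c}$ be a finitely generated nilpotent group given by a finite full rank presentation. Assume that the abelianization $G/G'$ of $G$ has trivial torsion subgroup. Then $G$ is trivial if $m\ge n$; it is infinite cyclic if $m=n-1$; and it is free nilpotent of class $c$ and rank $n-m$ if $m\le n-2$.
   Context: $G'=[G,G]$ is the derived subgroup. $\mathcal N_c$ is the variety of all nilpotent groups of class at most $c$. For $A=\{a_1,\dots,a_n\}$ and a finite set $R=\{r_1,\dots,r_m\}$ of words in $A^{\pm1}$, $\langle A\mid R\rangle_{\mathcal N_c}=N_c(A)/\langle\langle R\rangle\rangle$, where $N_c(A)=F(A)/\gamma_{c+1}(F(A))$ is the free group in $\mathcal N_c$ with basis $A$ and $\langle\langle R\rangle\rangle$ is the normal closure of $R$. A free nilpotent group of class $c$ and rank $k$ is a group isomorphic to $F/\gamma_{c+1}(F)$ with $F$ free of rank $k$. The relation matrix $M(A,R)$ is the $m\times n$ integer matrix whose $(i,j)$ entry is the sum of the exponents of all occurrences of $a_j$ in $r_i$; the presentation has full rank if $\operatorname{rank}M(A,R)=\min\{m,n\}$. *)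

(* Defs.v *)
From HB Require Import structures.
From mathcomp Require Import all_boot all_order all_algebra.
From mathcomp Require Import generic_quotient boolp classical_sets cardinality.

Set Implicit Arguments.
Unset Strict Implicit.
Unset Printing Implicit Defensive.

Local Open Scope classical_set_scope.
Local Open Scope group_scope.
Local Open Scope quotient_scope.

Definition subgroup (G : groupType) (H : set G) : Prop :=
  group_closed (mem H).

Definition normal_subgroup (G : groupType) (H : set G) : Prop :=
  subgroup H /\ forall x y : G, H x -> H (x ^ y).

Definition generated (G : groupType) (S : set G) : set G :=
  smallest (@subgroup G) S.

Definition normal_closure (G : groupType) (S : set G) : set G :=
  smallest (@normal_subgroup G) S.

Definition commutator_subgroup (G : groupType) (H K : set G) : set G :=
  generated [set z | exists x y, [/\ H x, K y & z = [~ x, y]]].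

Definition derived (G : groupType) : set G := commutator_subgroup setT setT.
Arguments derived : clear implicits.

(* [gamma G 1] is G and [gamma G k.+1] is [~: gamma G k, G] for k > 0; as for
   ['L_k(G)] in mathcomp.solvable.nilpotent, [gamma G 0] is also G. *)
Definition gamma (G : groupType) (k : nat) : set G :=
  iter k.-1 (fun H => commutator_subgroup H setT) setT.
Arguments gamma : clear implicits.

Lemma subgroupP (G : groupType) (H : set G) :
  subgroup H <-> H 1 /\ forall x y, H x -> H y -> H (x / y).
Proof.
split=> [[H1 HF]|[H1 HF]]; split.
- exact: set_mem.
- by move=> x y Hx Hy; apply: set_mem; apply: HF; apply: mem_set.
- exact: mem_set.
- by move=> x y /set_mem Hx /set_mem Hy; apply: mem_set; apply: HF.
Qed.

Lemma subgroup1 (G : groupType) (H : set G) : subgroup H -> H 1.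
Proof. by case/subgroupP. Qed.

Lemma subgroupV (G : groupType) (H : set G) x : subgroup H -> H x -> H x^-1.
Proof. by case/subgroupP=> H1 HF Hx; rewrite -div1g; apply: HF. Qed.

Lemma subgroupM (G : groupType) (H : set G) x y :
  subgroup H -> H x -> H y -> H (x * y).
Proof.
move=> sH Hx Hy; rewrite -(invgK y); case/subgroupP: (sH) => _; apply=> //.
exact: subgroupV.
Qed.

Lemma generated_subgroup (G : groupType) (S : set G) : subgroup (generated S).
Proof.
apply/subgroupP; split=> [H [sH _]|x y Sx Sy H HS]; first exact: subgroup1.
by have /subgroupP[_] := HS.1; apply; [apply: Sx | apply: Sy].
Qed.

Lemma normal_closure_normal (G : groupType) (S : set G) :
  normal_subgroup (normal_closure S).
Proof.
split=> [|x y Sx H HS]; last by apply: HS.1.2; apply: Sx.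
apply/subgroupP; split=> [H [[sH _] _]|x y Sx Sy H HS]; first exact: subgroup1.
by have /subgroupP[_] := HS.1.1; apply; [apply: Sx | apply: Sy].
Qed.

Lemma setT_normal (G : groupType) : normal_subgroup [set: G].
Proof. by split=> //; apply/subgroupP. Qed.

Lemma commutator_subgroup_normal (G : groupType) (H K : set G) :
  normal_subgroup H -> normal_subgroup K ->
  normal_subgroup (commutator_subgroup H K).
Proof.
move=> nH nK; split; first exact: generated_subgroup.
move=> x y Hx; pose T := [set x | commutator_subgroup H K (x ^ y)].
have sHK := generated_subgroup [set z | exists x y, [/\ H x, K y & z = [~ x, y]]].
apply: (Hx T); split=> [|_ [u [v [Hu Kv ->]]]].
  apply/subgroupP; split=> [|u v Hu Hv].
    by rewrite /T /= conj1g; apply: (subgroup1 sHK).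
  rewrite /T /= conjMg conjVg.
  by apply: (subgroupM sHK) => //; apply: (subgroupV sHK).
rewrite /T /= conjRg; apply: sub_gen_smallest; exists (u ^ y), (v ^ y).
by split=> //; [apply: nH.2 | apply: nK.2].
Qed.

Lemma derived_normal (G : groupType) : normal_subgroup (derived G).
Proof. by apply: commutator_subgroup_normal; apply: setT_normal. Qed.

Lemma gamma_normal (G : groupType) (k : nat) : normal_subgroup (gamma G k).
Proof.
rewrite /gamma; elim: k.-1 => [|j IHj]; first exact: setT_normal.
by rewrite iterS; apply: commutator_subgroup_normal => //; apply: setT_normal.
Qed.

Section Quotient.
Variables (G : groupType) (N : set G) (nN : normal_subgroup N).

Definition coset_rel : rel G := fun x y => `[< N (x^-1 * y) >].

Fact coset_rel_refl : reflexive coset_rel.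
Proof. by move=> x; apply/asboolP; rewrite mulVg; apply: (subgroup1 nN.1). Qed.

Fact coset_rel_sym : symmetric coset_rel.
Proof.
by move=> x y; apply/asboolP/asboolP=> /(subgroupV nN.1); rewrite invgM invgK.
Qed.

Fact coset_rel_trans : transitive coset_rel.
Proof.
move=> y x z /asboolP xy /asboolP yz; apply/asboolP.
by have := subgroupM nN.1 xy yz; rewrite -mulgA mulVKg.
Qed.

Canonical coset_equiv :=
  EquivRel coset_rel coset_rel_refl coset_rel_sym coset_rel_trans.

Definition quotient := {eq_quot coset_equiv}.
HB.instance Definition _ := Choice.on quotient.

Definition coset (x : G) : quotient := \pi_{eq_quot coset_equiv} x.

Lemma coset_eq (x y : G) : coset x = coset y <-> N (x^-1 * y).
Proof.
by split=> [/eqP|Nxy]; [rewrite eqmodE => /asboolP | apply/eqP; rewrite eqmodE;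
  apply/asboolP].
Qed.

Definition quot_one : quotient := coset 1.
Definition quot_inv (u : quotient) : quotient := coset (repr u)^-1.
Definition quot_mul (u v : quotient) : quotient := coset (repr u * repr v).

Lemma coset_surj (u : quotient) : exists x, u = coset x.
Proof. by exists (repr u); rewrite /coset reprK. Qed.

Lemma repr_coset (x : G) : N ((repr (coset x))^-1 * x).
Proof. by apply/coset_eq; rewrite /coset reprK. Qed.

Lemma cosetV (x : G) : quot_inv (coset x) = coset x^-1.
Proof.
apply/coset_eq; rewrite invgK; have /(subgroupV nN.1) := repr_coset x.
rewrite invgM invgK => /(nN.2 _ x^-1).
by rewrite /conjg invgK !mulgA mulgV mul1g.
Qed.

Lemma cosetM (x y : G) : quot_mul (coset x) (coset y) = coset (x * y).
Proof.
apply/coset_eq; set x' := repr _; set y' := repr _.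
have Nx : N (x'^-1 * x) := repr_coset x.
have Ny : N (y'^-1 * y) := repr_coset y.
have := subgroupM nN.1 (nN.2 _ y' Nx) Ny.
by rewrite /conjg invgM -!mulgA mulVKg.
Qed.

Fact quot_mulA : associative quot_mul.
Proof.
move=> u v w; have [x ->] := coset_surj u; have [y ->] := coset_surj v.
by have [z ->] := coset_surj w; rewrite !cosetM mulgA.
Qed.

Fact quot_mul1 : left_id quot_one quot_mul.
Proof. by move=> u; have [x ->] := coset_surj u; rewrite cosetM mul1g. Qed.

Fact quot_1mul : right_id quot_one quot_mul.
Proof. by move=> u; have [x ->] := coset_surj u; rewrite cosetM mulg1. Qed.

Fact quot_mulV : left_inverse quot_one quot_inv quot_mul.
Proof. by move=> u; have [x ->] := coset_surj u; rewrite cosetV cosetM mulVg. Qed.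

Fact quot_Vmul : right_inverse quot_one quot_inv quot_mul.
Proof. by move=> u; have [x ->] := coset_surj u; rewrite cosetV cosetM mulgV. Qed.

HB.instance Definition _ := isGroup.Build quotient
  quot_mulA quot_mul1 quot_1mul quot_mulV quot_Vmul.

Lemma coset_morph : {morph coset : x y / x * y}.
Proof. by move=> x y; rewrite -cosetM. Qed.

HB.instance Definition _ := isMultiplicative.Build G quotient coset coset_morph.

End Quotient.

(* The letter [(a, false)] stands for a and [(a, true)] for a^-1. *)
Definition word (A : Type) := seq (A * bool).

Section FreeGroup.
Variable A : choiceType.
Implicit Types u v w : word A.

Definition inv_letter (l : A * bool) : A * bool := (l.1, ~~ l.2).
Definition inv_word w : word A := rev (map inv_letter w).

Inductive free_eq : word A -> word A -> Prop :=
| free_cancel u l v : free_eq (u ++ [:: l; inv_letter l] ++ v) (u ++ v)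
| free_refl u : free_eq u u
| free_sym u v : free_eq u v -> free_eq v u
| free_trans v u w : free_eq u v -> free_eq v w -> free_eq u w.

Definition free_rel : rel (word A) := fun u v => `[< free_eq u v >].

Fact free_rel_refl : reflexive free_rel.
Proof. by move=> u; apply/asboolP/free_refl. Qed.

Fact free_rel_sym : symmetric free_rel.
Proof. by move=> u v; apply/asboolP/asboolP => /free_sym. Qed.

Fact free_rel_trans : transitive free_rel.
Proof.
by move=> v u w /asboolP uv /asboolP vw; apply/asboolP/(free_trans uv).
Qed.

Canonical free_equiv :=
  EquivRel free_rel free_rel_refl free_rel_sym free_rel_trans.

Definition free_group := {eq_quot free_equiv}.
HB.instance Definition _ := Choice.on free_group.

Definition free_class w : free_group := \pi_{eq_quot free_equiv} w.

Lemma free_class_eq u v : free_class u = free_class v <-> free_eq u v.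
Proof.
by split=> [/eqP|e]; [rewrite eqmodE => /asboolP | apply/eqP; rewrite eqmodE;
  apply/asboolP].
Qed.

Definition free_one : free_group := free_class [::].
Definition free_inv (x : free_group) := free_class (inv_word (repr x)).
Definition free_mul (x y : free_group) := free_class (repr x ++ repr y).

Lemma free_class_surj (x : free_group) : exists w, x = free_class w.
Proof. by exists (repr x); rewrite /free_class reprK. Qed.

Lemma repr_free_class w : free_eq (repr (free_class w)) w.
Proof. by apply/free_class_eq; rewrite /free_class reprK. Qed.

Lemma inv_letterK : involutive inv_letter.
Proof. by case=> a b; rewrite /inv_letter /= negbK. Qed.

Lemma inv_word_cat u v : inv_word (u ++ v) = inv_word v ++ inv_word u.
Proof. by rewrite /inv_word map_cat rev_cat. Qed.

Lemma inv_wordK : involutive inv_word.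
Proof.
move=> w; rewrite /inv_word map_rev revK -map_comp -[RHS]map_id.
by apply: eq_map => l /=; rewrite inv_letterK.
Qed.

Lemma free_eq_catl s u v : free_eq u v -> free_eq (s ++ u) (s ++ v).
Proof.
elim=> {u v} [u l v|u|u v _ /free_sym//|v u w _ uv _ vw].
- by rewrite !(catA s); apply: free_cancel.
- exact: free_refl.
- exact: free_trans uv vw.
Qed.

Lemma free_eq_catr s u v : free_eq u v -> free_eq (u ++ s) (v ++ s).
Proof.
elim=> {u v} [u l v|u|u v _ /free_sym//|v u w _ uv _ vw].
- by rewrite -!catA; apply: free_cancel.
- exact: free_refl.
- exact: free_trans uv vw.
Qed.

Lemma free_eq_inv u v : free_eq u v -> free_eq (inv_word u) (inv_word v).
Proof.
elim=> {u v} [u l v|u|u v _ /free_sym//|v u w _ uv _ vw].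
- rewrite !inv_word_cat -catA.
  rewrite (_ : inv_word [:: l; _] = [:: l; inv_letter l]).
    exact: free_cancel.
  by rewrite /inv_word /= inv_letterK.
- exact: free_refl.
- exact: free_trans uv vw.
Qed.

Lemma free_classV w : free_inv (free_class w) = free_class (inv_word w).
Proof. exact/free_class_eq/free_eq_inv/repr_free_class. Qed.

Lemma free_classM u v :
  free_mul (free_class u) (free_class v) = free_class (u ++ v).
Proof.
apply/free_class_eq/(@free_trans (repr (free_class u) ++ v)).
  exact/free_eq_catl/repr_free_class.
exact/free_eq_catr/repr_free_class.
Qed.

Lemma free_eq_Vcat w : free_eq (inv_word w ++ w) [::].
Proof.
elim: w => [|l w IHw]; first exact: free_refl.
rewrite -cat1s inv_word_cat -catA; apply: free_trans IHw.
have := free_cancel (inv_word w) (inv_letter l) w.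
by rewrite inv_letterK.
Qed.

Fact free_mulA : associative free_mul.
Proof.
move=> x y z; have [u ->] := free_class_surj x.
have [v ->] := free_class_surj y; have [w ->] := free_class_surj z.
by rewrite !free_classM catA.
Qed.

Fact free_mul1 : left_id free_one free_mul.
Proof. by move=> x; have [u ->] := free_class_surj x; rewrite free_classM. Qed.

Fact free_1mul : right_id free_one free_mul.
Proof.
by move=> x; have [u ->] := free_class_surj x; rewrite free_classM cats0.
Qed.

Fact free_mulV : left_inverse free_one free_inv free_mul.
Proof.
move=> x; have [u ->] := free_class_surj x.
by rewrite free_classV free_classM; apply/free_class_eq/free_eq_Vcat.
Qed.

Fact free_Vmul : right_inverse free_one free_inv free_mul.
Proof.
move=> x; have [u ->] := free_class_surj x; rewrite free_classV free_classM.
by apply/free_class_eq; rewrite -{1}(inv_wordK u); apply: free_eq_Vcat.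
Qed.

HB.instance Definition _ := isGroup.Build free_group
  free_mulA free_mul1 free_1mul free_mulV free_Vmul.

End FreeGroup.

Definition free_nilpotent (c : nat) (A : choiceType) : groupType :=
  quotient (gamma_normal (free_group A) c.+1).

Definition word_class (c : nat) (A : choiceType) (w : word A) :
    free_nilpotent c A :=
  coset (gamma_normal (free_group A) c.+1) (free_class w).

Section Presentation.
Variables (c n m : nat) (r : 'I_m -> word 'I_n).

Definition relators : set (free_nilpotent c 'I_n) :=
  range (fun i => word_class c (r i)).

Definition nilpotent_presentation : groupType :=
  quotient (normal_closure_normal relators).

Definition exponent_sum (w : word 'I_n) (j : 'I_n) : int :=
  (\sum_(l <- w | l.1 == j) (-1) ^+ l.2)%R.

Definition relation_matrix : 'M[int]_(m, n) :=
  (\matrix_(i, j) exponent_sum (r i) j)%R.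

Definition full_rank : Prop :=
  \rank (map_mx (intr : int -> rat) relation_matrix) = minn m n.

End Presentation.

Definition abelianization (G : groupType) : groupType :=
  quotient (derived_normal G).

Definition torsion (G : groupType) : set G :=
  [set x | exists2 k : nat, (0 < k)%N & x ^+ k = 1].
Arguments torsion : clear implicits.

Definition trivial_group (G : groupType) : Prop := [set: G] = [set 1].

Definition infinite_cyclic (G : groupType) : Prop :=
  infinite_set [set: G] /\ exists g : G, generated [set g] = [set: G].

Definition isomorphic (G H : groupType) : Prop :=
  exists f : {multiplicative G -> H}, bijective f.

Definition is_free_nilpotent (c k : nat) (G : groupType) : Prop :=
  isomorphic G (free_nilpotent c 'I_k).

(* Main.v *)
Require Import Defs.
From HB Require Import structures.
From mathcomp Require Import all_boot all_order all_algebra.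
From mathcomp Require Import boolp classical_sets cardinality.

(** Let [N] be the free nilpotent group of class [c] on [n] generators, [G] its
    quotient by the relators, and [M] the relation matrix.  Everything is
    reduced to linear algebra over the integers by two facts about [N].

    First, the exponent sums define a morphism [expo] from [N] to the row
    vectors of length [n], and this is the abelianization of [N]: a morphism to
    an abelian group factors through it ([hom_abelian]), so its kernel is the
    derived subgroup ([expo_inj_derived]).  Consequently [G/G'] is the quotient
    of the row vectors by the row lattice of [M] ([derived_relation_lattice]),
    and [G/G'] is torsion-free exactly when this lattice is saturated: it
    contains every vector of which it contains a positive multiple.

    Second, an endomorphism of a nilpotent group that is the identity modulo
    the derived subgroup is bijective ([bij_mod_derived]), because it then acts
    trivially on every factor of the lower central series ([id_mod_derived]).
    Hence any [n] elements of [N] whose exponent vectors form a unimodular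
    matrix are the images of the generators under an automorphism of [N]
    ([hom_mod_derived_bij], applied to both composites with an endomorphism
    that realizes the inverse matrix).

    By the Smith normal form, a saturated lattice of full rank is everything
    when [n <= m] ([saturated_full]), and otherwise the rows of [M] extend to a
    unimodular matrix ([saturated_unimodular]).  In the first case [G] is
    perfect and nilpotent, hence trivial.  In the second case an automorphism
    of [N] carries the first [m] generators to the relators, so that [G] is the
    quotient of [N] by [m] of its generators, which is free nilpotent of rank
    [n - m] ([presentation_free]); for rank one that group is infinite
    cyclic. *)

Set Implicit Arguments.
Unset Strict Implicit.
Unset Printing Implicit Defensive.

Local Open Scope classical_set_scope.
Local Open Scope group_scope.

Local Notation hom := UMagmaMorphism.type.
Local Notation mul_of := Algebra.to_multiplicative.

(** * Subgroups and the lower central series *)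

Section GroupBasics.
Implicit Types G H K : groupType.

Lemma generated_sub G (S T : set G) :
  subgroup T -> S `<=` T -> generated S `<=` T.
Proof. exact: smallest_sub. Qed.

Lemma subgroup_preimage G H (f : hom G H) (T : set H) :
  subgroup T -> subgroup (f @^-1` T).
Proof.
move=> /subgroupP[T1 TF]; apply/subgroupP; split=> [|x y Tx Ty] /=.
  by rewrite gmulf1.
by rewrite gmulfF; apply: TF.
Qed.

Lemma subgroup_image G H (f : hom G H) (T : set G) :
  subgroup T -> subgroup (f @` T).
Proof.
move=> /subgroupP[T1 TF]; apply/subgroupP; split=> [|_ _ [x Tx <-] [y Ty <-]].
  by exists 1 => //; rewrite gmulf1.
by exists (x / y); [apply: TF | rewrite gmulfF].
Qed.

Lemma subgroup_equalizer G H (f g : hom G H) : subgroup [set x | f x = g x].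
Proof.
apply/subgroupP; split=> [|x y /= fgx fgy]; first by rewrite /= !gmulf1.
by rewrite !gmulfF fgx fgy.
Qed.

Lemma kernel_normal G H (f : hom G H) : normal_subgroup [set x | f x = 1].
Proof.
split=> [|x y /= fx1]; last by rewrite gmulfJ fx1 conj1g.
apply/subgroupP; split=> [|x y /= fx fy]; first exact: gmulf1.
by rewrite gmulfF fx fy divg1.
Qed.

Lemma centralizer_subgroup G (x : G) : subgroup [set y | commute x y].
Proof.
apply/subgroupP; split=> [|y z /= cxy cxz]; first exact: commute1.
by apply: commuteM => //; apply: commuteV.
Qed.

Lemma comm_mem G (S T : set G) x y :
  S x -> T y -> commutator_subgroup S T [~ x, y].
Proof. by move=> Sx Ty; apply: sub_gen_smallest; exists x, y. Qed.

Lemma gammaSS G k :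
  gamma G k.+2 = commutator_subgroup (gamma G k.+1) setT.
Proof. by []. Qed.

Lemma gamma2 G : gamma G 2 = derived G.
Proof. by []. Qed.

Lemma gamma_comm G k x y : gamma G k.+1 x -> gamma G k.+2 [~ x, y].
Proof. by move=> Gx; apply: comm_mem. Qed.

Lemma gamma_anti G k : gamma G k.+2 `<=` gamma G k.+1.
Proof.
have [sG nG] := gamma_normal G k.+1.
apply: generated_sub => // _ [x [y [Gx _ ->]]].
by rewrite commgEl; apply: subgroupM => //; [apply: subgroupV | apply: nG].
Qed.

Lemma gamma_le G j k : (j <= k)%N -> gamma G k.+1 `<=` gamma G j.+1.
Proof.
by move/subnKC <-; elim: (k - j)%N => [|i IHi] x;
  rewrite ?addn0 // addnS => /gamma_anti/IHi.
Qed.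

Lemma gamma_derived G k : gamma G k.+2 `<=` derived G.
Proof. by elim: k => [|k IHk] // x /gamma_anti/IHk. Qed.

Lemma gamma_hom G H (f : hom G H) k x : gamma G k.+1 x -> gamma H k.+1 (f x).
Proof.
elim: k x => [|k IHk] x //; apply: (generated_sub (T := f @^-1` gamma H k.+2)).
  by apply: subgroup_preimage; case: (gamma_normal H k.+2).
move=> _ [u [v [Gu _ ->]]] /=; rewrite gmulfR; apply: gamma_comm; exact: IHk.
Qed.

Lemma gamma_surj G H (f : hom G H) k : (forall y, exists x, f x = y) ->
  gamma H k.+1 `<=` f @` gamma G k.+1.
Proof.
move=> f_surj; elim: k => [|k IHk].
  by move=> y _; have [x] := f_surj y; exists x.
apply: generated_sub.
  by apply: subgroup_image; case: (gamma_normal G k.+2).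
move=> _ [_ [v [/IHk[x Gx <-] _ ->]]]; have [y <-] := f_surj v.
by exists [~ x, y]; [apply: gamma_comm | rewrite gmulfR].
Qed.

Lemma abelian_derived G : (forall x y : G, commute x y) ->
  derived G `<=` [set 1].
Proof.
move=> abG; apply: generated_sub => [|_ [x [y [_ _ ->]]]].
  by apply/subgroupP; split=> // x y /= -> ->; rewrite divg1.
exact/eqP/commgP.
Qed.

Lemma abelian_nilpotent G c : (forall x y : G, commute x y) ->
  gamma G c.+2 `<=` [set 1].
Proof. by move=> abG x /gamma_derived; apply: abelian_derived. Qed.

Lemma perfect_nilpotent G c :
  gamma G c.+1 `<=` [set 1] -> derived G = setT -> trivial_group G.
Proof.
move=> nilG perfG; apply/seteqP; split=> // x _; apply: nilG.
suff -> : gamma G c.+1 = setT by [].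
by elim: c => // c IHc; rewrite gammaSS IHc; apply: perfG.
Qed.

End GroupBasics.

(** * Quotients *)

Section Cosets.
Variables (G : groupType) (N : set G) (nN : normal_subgroup N).

HB.instance Definition _ := Multiplicative_isUMagmaMorphism.Build
  G (quotient nN) (coset nN) (erefl _).

Lemma coset_eq1 x : coset nN x = 1 <-> N x.
Proof.
split=> [/esym/coset_eq|Nx]; first by rewrite invg1 mul1g.
by apply/esym/coset_eq; rewrite invg1 mul1g.
Qed.

Section Lift.
Variables (H : groupType) (f : hom G H).

(** The argument about [N] does not enter the body: it is there so that the
    morphism structure can be inferred from the term. *)
Definition quotient_lift (_ : forall x, N x -> f x = 1) (u : quotient nN) : H :=
  f (repr u).

Hypothesis kf : forall x, N x -> f x = 1.

Lemma quotient_liftE x : quotient_lift kf (coset nN x) = f x.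
Proof.
have /kf := repr_coset nN x; rewrite gmulfM gmulfV => /mulg1_eq.
by rewrite invgK.
Qed.

Fact quotient_lift_morphism : monoid_morphism (quotient_lift kf).
Proof.
split=> [|u v]; first exact: etrans (quotient_liftE 1) gmulf1.
have [[x ->] [y ->]] := (coset_surj u, coset_surj v).
by rewrite -gmulfM !quotient_liftE gmulfM.
Qed.

HB.instance Definition _ := isUMagmaMorphism.Build (quotient nN) H
  (quotient_lift kf) quotient_lift_morphism.

End Lift.
End Cosets.
Arguments quotient_liftE {G N nN H f} kf x.

Lemma abelianization_commute (G : groupType) (x y : abelianization G) :
  commute x y.
Proof.
have [[{}x ->] [{}y ->]] := (coset_surj x, coset_surj y).
by apply/commgP; rewrite -gmulfR; apply/eqP/coset_eq1; apply: comm_mem.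
Qed.

(** * Endomorphisms that are trivial modulo the derived subgroup *)

Section CentralSeries.
Implicit Types G : groupType.

(** If the commutators of the conjugates of [x] are central, then
    [x ^ (a * b) = x * [~ x, b] * [~ x, a]] is symmetric in [a] and [b], so that
    conjugation by [~ y, z] fixes [x].  With [x] in the [k]-th term of the lower
    central series of a group of class [k.+1], this is the instance of the three
    subgroups lemma that is used below. *)
Lemma commute_derived G (x : G) :
  (forall y z w, commute [~ x ^ w, y] z) ->
  forall v, derived G v -> commute x v.
Proof.
move=> Zx; apply: generated_sub => [|_ [y [z [_ _ ->]]]].
  exact: centralizer_subgroup.
have conj2 w a b : (x ^ w) ^ (a * b) = x ^ w * ([~ x ^ w, b] * [~ x ^ w, a]).
  have Eu d : (x ^ w) ^ d = x ^ w * [~ x ^ w, d] by rewrite commgEl mulVKg.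
  rewrite conjgM [in LHS]Eu conjMg Eu -mulgA; congr (_ * (_ * _)).
  by apply/conjg_fixP/commgP/Zx.
have swap w a b : (x ^ w) ^ (a * b) = (x ^ w) ^ (b * a).
  by rewrite !conj2; congr (_ * _); apply: Zx.
apply/commgP; rewrite -conjg_fix; apply/eqP.
rewrite (_ : [~ y, z] = (z * y)^-1 * (y * z)); last by rewrite invgM -mulgA.
by rewrite conjgM swap -conjgM mulVg conjg1.
Qed.

Lemma commute_coset_gamma G k (x : G) : gamma G k.+1 x ->
  forall z, commute (coset (gamma_normal G k.+2) x) z.
Proof.
move=> Gx z; have [y ->] := coset_surj z.
by apply/commgP; rewrite -gmulfR; apply/eqP/coset_eq1; apply: gamma_comm.
Qed.

(** Induction on [k]: if [f x = x * u] with [u] in the next term and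
    [f y = y * v] with [v] in the derived subgroup, then modulo
    [gamma G k.+3] the factor [u] is central and [v] commutes with [x], so that
    [~ x * u, y * v] and [~ x, y] agree. *)
Lemma id_mod_derived G (f : hom G G) :
  (forall x, derived G (x^-1 * f x)) ->
  forall k x, gamma G k.+1 x -> gamma G k.+2 (x^-1 * f x).
Proof.
move=> f_id; elim=> [|k IHk] x; first by move=> _; apply: f_id.
pose p : hom G (quotient (gamma_normal G k.+3)) := coset (gamma_normal G k.+3).
pose T := [set x | p x = (p \o f) x].
suff: gamma G k.+2 `<=` T by move=> GT /GT/coset_eq.
apply: generated_sub => [|_ [{}x [y [Gx _ ->]]]].
  exact: subgroup_equalizer.
have pC z w : gamma G k.+2 z -> commute (p z) w.
  by move=> Gz; apply: commute_coset_gamma.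
have px_derived v : derived (quotient (gamma_normal G k.+3)) v ->
    commute (p x) v.
  apply: commute_derived => a b w.
  have [[{}a ->] [{}b ->]] := (coset_surj a, coset_surj b).
  have [{}w ->] := coset_surj w.
  rewrite -gmulfJ -gmulfR; apply: pC; apply: gamma_comm.
  by have [_ nG] := gamma_normal G k.+1; apply: nG.
have fE z : p (f z) = p z * p (z^-1 * f z) by rewrite -gmulfM mulVKg.
have pfx_comm : p (f [~ x, y]) = [~ p x * p (x^-1 * f x), p y * p (y^-1 * f y)].
  by rewrite 2!gmulfR !fE.
rewrite /T /= pfx_comm gmulfR.
set u := p (x^-1 * f x); set v := p (y^-1 * f y).
have uC w : commute u w by apply: pC; apply: IHk.
have xv : commute (p x) v.
  by apply: px_derived; rewrite -gamma2; apply: gamma_hom; apply: f_id.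
have xyC w : commute [~ p x, p y] w.
  by rewrite -gmulfR; apply: pC; apply: gamma_comm.
have fixC (a b : quotient (gamma_normal G k.+3)) : commute a b -> a ^ b = a.
  by move=> cab; apply/conjg_fixP/commgP.
have ux_comm z : [~ p x * u, z] = [~ p x, z].
  apply: (mulgI u); rewrite [RHS]uC !commgEl conjMg (fixC u) // invgM.
  by rewrite !mulgA mulgV mul1g.
rewrite ux_comm !commgEl conjgM -[p x ^ p y](mulVKg (p x)) -commgEl.
by rewrite conjMg !fixC // mulKg.
Qed.

(** The kernel descends, and the image ascends, along the lower central series:
    an element of [gamma G k.+1] killed by [f] lies in [gamma G k.+2], and
    one of [gamma G k.+1] is in the image as soon as [gamma G k.+2] is. *)
Lemma bij_mod_derived G c (f : hom G G) : gamma G c.+1 `<=` [set 1] ->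
  (forall x, derived G (x^-1 * f x)) ->
  injective f /\ forall y, exists x, f x = y.
Proof.
move=> nilG f_id; have fG := id_mod_derived f_id; split.
  apply: gmulf_inj => x fx1; apply: nilG.
  suff Gx k : gamma G k.+1 x by [].
  elim: k => // k /fG; rewrite fx1 mulg1 => Gx.
  by rewrite -[x]invgK; apply: subgroupV Gx; case: (gamma_normal G k.+2).
(* [d] bounds the number of steps from [k] to the class [c]. *)
suff Gf d k : (c <= d + k)%N -> gamma G k.+1 `<=` range f.
  by move=> y; have [] := Gf c 0 _ y; rewrite ?addn0 // => x _ <-; exists x.
elim: d k => [|d IHd] k ck y Gy.
  exists 1 => //; rewrite gmulf1; symmetry; apply: nilG.
  exact: gamma_le Gy.
have [|z _ fz] := IHd k.+1 _ _ (fG _ _ Gy); first by rewrite addnS.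
by exists (y * z^-1) => //; rewrite gmulfF fz invgM invgK mulVKg.
Qed.

End CentralSeries.

(** * The universal property of free nilpotent groups *)

Section FreeNilpotent.
Variable A : choiceType.

Lemma free_class_cat (u v : word A) :
  free_class (u ++ v) = free_class u * free_class v :> free_group A.
Proof. by rewrite -free_classM. Qed.

Section WordEval.
Variables (H : groupType) (f : A -> H).

Definition word_eval (w : word A) : H :=
  \prod_(l <- w) (if l.2 then (f l.1)^-1 else f l.1).

Lemma word_eval_cat u v : word_eval (u ++ v) = word_eval u * word_eval v.
Proof. exact: big_cat. Qed.

Lemma word_eval_free_eq u v : free_eq u v -> word_eval u = word_eval v.
Proof.
elim=> {u v} // [u [a b] v|u v w _ -> _ ->] //.
rewrite !word_eval_cat; congr (_ * _); rewrite {1}/word_eval !big_cons big_nil.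
by case: b; rewrite /= ?mulg1 (mulgV, mulVg) mul1g.
Qed.

Definition free_lift (x : free_group A) : H := word_eval (repr x).

Lemma free_liftE w : free_lift (free_class w) = word_eval w.
Proof. exact/word_eval_free_eq/repr_free_class. Qed.

Fact free_lift_morphism : monoid_morphism free_lift.
Proof.
split=> [|x y]; first by rewrite [LHS](free_liftE [::]) /word_eval big_nil.
have [[u ->] [v ->]] := (free_class_surj x, free_class_surj y).
by rewrite -free_class_cat !free_liftE word_eval_cat.
Qed.

HB.instance Definition _ :=
  isUMagmaMorphism.Build (free_group A) H free_lift free_lift_morphism.

End WordEval.

Variable c : nat.
Local Notation N := (free_nilpotent c A).

Definition gen (a : A) : N := word_class c [:: (a, false)].

Lemma word_class_surj (x : N) : exists w, x = word_class c w.
Proof.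
have [y ->] := coset_surj x; have [w ->] := free_class_surj y.
by exists w.
Qed.

Lemma free_nilpotent_gamma : gamma N c.+1 `<=` [set 1].
Proof.
move=> y Ny; pose p : hom (free_group A) N := coset (gamma_normal _ c.+1).
have [|x Gx <-] := gamma_surj (f := p) _ Ny; last exact/coset_eq1.
by move=> z; have [x ->] := coset_surj z; exists x.
Qed.

Lemma free_nilpotent_lift (H : groupType) (f : A -> H) :
  gamma H c.+1 `<=` [set 1] ->
  exists g : hom N H, forall a, g (gen a) = f a.
Proof.
move=> nilH; have kf x : gamma (free_group A) c.+1 x -> free_lift f x = 1.
  by move=> /(gamma_hom (free_lift f))/nilH.
exists (quotient_lift kf) => a.
have /= -> := quotient_liftE kf (free_class [:: (a, false)]).
by rewrite free_liftE /word_eval big_seq1.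
Qed.

Lemma hom_word_class (H : groupType) (g : hom N H) w :
  g (word_class c w) = word_eval (g \o gen) w.
Proof.
elim: w => [|[a b] w IHw]; first by rewrite /word_eval big_nil gmulf1.
rewrite -cat1s word_eval_cat -IHw /word_class free_class_cat !gmulfM.
congr (_ * _); rewrite /word_eval big_seq1 /=; case: b => //.
rewrite -gmulfV; congr (g _); rewrite /gen /word_class -gmulfV.
by congr coset; rewrite -[RHS]/(free_inv _) free_classV.
Qed.

Lemma free_nilpotent_ext (H : groupType) (g h : hom N H) :
  (forall a, g (gen a) = h (gen a)) -> g =1 h.
Proof.
move=> gh x; have [w ->] := word_class_surj x.
by rewrite !hom_word_class; apply: eq_bigr => -[a b] _ /=; rewrite gh.
Qed.

End FreeNilpotent.

(** * Exponent vectors and the abelianization of a free nilpotent group *)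

Section AbelianGroup.
Variables (H : groupType) (abH : forall x y : H, commute x y).

(** An abelian group written additively, which makes integer multiples and
    finite sums available; the inverse operation is [mul_of]. *)
Definition zmodule_of (_ : forall x y : H, commute x y) : Type := H.
HB.instance Definition _ := Choice.on (zmodule_of abH).
Fact zmodule_mulC : commutative (fun x y : H => x * y).
Proof. exact: abH. Qed.
HB.instance Definition _ := GRing.isZmodule.Build (zmodule_of abH)
  (@mulgA H) zmodule_mulC (@mul1g H) (@mulVg H).
End AbelianGroup.

Section Exponents.
Variable n : nat.
Implicit Type V : zmodType.

Definition lincomb V (f : 'I_n -> V) (v : 'rV[int]_n) : V :=
  (\sum_j f j *~ v ord0 j)%R.

Lemma lincombD V (f : 'I_n -> V) u v :
  lincomb f (u + v)%R = (lincomb f u + lincomb f v)%R.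
Proof.
rewrite -big_split; apply: eq_bigr => j _ /=.
by rewrite mxE mulrzDr.
Qed.

Lemma lincomb_mul V (f : 'I_n -> V) m (t : 'rV[int]_m) (M : 'M[int]_(m, n)) :
  lincomb f (t *m M)%R = (\sum_i lincomb f (row i M) *~ t ord0 i)%R.
Proof.
rewrite /lincomb; under eq_bigr do rewrite mxE mulrz_sumr.
rewrite exchange_big; apply: eq_bigr => i _; rewrite mulrz_suml.
by apply: eq_bigr => j _; rewrite mxE [(t _ _ * _)%R]GRing.mulrC mulrzA.
Qed.

Definition exponents (w : word 'I_n) : 'rV[int]_n :=
  (\row_j exponent_sum w j)%R.

Lemma exponents_cons a b w :
  exponents ((a, b) :: w) =
  ((if b then - delta_mx ord0 a else delta_mx ord0 a) + exponents w)%R.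
Proof.
apply/rowP => j; rewrite !mxE /exponent_sum !big_mkcond big_cons /=.
congr (_ + _)%R; last by rewrite -big_mkcond.
by case: b; rewrite !mxE eqxx /= eq_sym; case: eqP.
Qed.

Lemma lincomb_delta V (f : 'I_n -> V) j : lincomb f (delta_mx ord0 j) = f j.
Proof.
rewrite /lincomb (bigD1 j) //= big1 ?mxE ?eqxx ?GRing.addr0 ?mulr1z // => i ij.
by rewrite mxE eqxx (negPf ij) mulr0z.
Qed.

Lemma word_eval_abelian V (f : 'I_n -> mul_of V) w :
  word_eval f w = lincomb f (exponents w).
Proof.
elim: w => [|[a b] w IHw].
  rewrite /word_eval big_nil /lincomb big1 // => j _.
  by rewrite mxE /exponent_sum big_nil.
rewrite exponents_cons lincombD -IHw /word_eval big_cons /=.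
congr (_ + _)%R; case: b; rewrite ?lincomb_delta //.
rewrite -[LHS]/(- _)%R -[in LHS](lincomb_delta f a) /lincomb.
by rewrite -GRing.sumrN; apply: eq_bigr => j _; rewrite -mulrNz [in RHS]mxE.
Qed.

End Exponents.

Lemma mul_of_commute (V : zmodType) (x y : mul_of V) : commute x y.
Proof. exact: GRing.addrC. Qed.

Lemma mul_ofX (V : zmodType) (v : mul_of V) k : v ^+ k = (v *+ k)%R.
Proof. by elim: k => // k IHk; rewrite expgS IHk GRing.mulrS. Qed.

Section ExponentMorphism.
Variables (c n : nat).
Local Notation N := (free_nilpotent c.+1 'I_n).

(** The class is written as a successor because an abelian target requires it
    to be at least one. *)
Definition expo : hom N (mul_of 'rV[int]_n) :=
  projT1 (cid (free_nilpotent_lift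
    (fun j => delta_mx ord0 j : mul_of 'rV[int]_n)
    (abelian_nilpotent (@mul_of_commute 'rV[int]_n)))).

Lemma expo_gen j : expo (gen c.+1 j) = delta_mx ord0 j.
Proof. by rewrite /expo; case: cid => /= e ->. Qed.

Lemma expo_word w : expo (word_class c.+1 w) = exponents w.
Proof.
rewrite hom_word_class word_eval_abelian /lincomb.
rewrite [RHS]row_sum_delta; apply: eq_bigr => j _ /=.
by rewrite expo_gen -[in RHS](intz (exponents w _ _)) scaler_int.
Qed.

Lemma hom_expo (V : zmodType) (g : hom N (mul_of V)) x :
  g x = lincomb (fun j => g (gen c.+1 j)) (expo x).
Proof.
have [w ->] := word_class_surj x.
by rewrite hom_word_class word_eval_abelian expo_word.
Qed.

Lemma expo_surj v : exists x, expo x = v.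
Proof.
pose P (u : 'rV[int]_n) := exists x, expo x = u.
have PD u w : P u -> P w -> P (u + w)%R.
  by move=> [x <-] [y <-]; exists (x * y); rewrite gmulfM.
have PV u : P u -> P (- u)%R by move=> [x <-]; exists (x^-1); rewrite gmulfV.
have P0 : P 0%R by exists 1; rewrite gmulf1.
have PX u k : P u -> P (u *+ k)%R.
  by move=> Pu; elim: k => // k IHk; rewrite GRing.mulrS; apply: PD.
rewrite -/(P v) [v]row_sum_delta; apply: big_ind => // j _.
have Pj : P (delta_mx ord0 j) by exists (gen c.+1 j); rewrite expo_gen.
rewrite -[v _ _]intz scaler_int.
by case: (v _ _) => k; [apply: PX | apply/PV/PX].
Qed.

End ExponentMorphism.
Arguments expo {c n}.

Section HomKernel.
Variables (c n : nat).
Local Notation N := (free_nilpotent c.+1 'I_n).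

Lemma hom_abelian (H : groupType) (abH : forall x y : H, commute x y)
    (g : hom N H) x :
  g x = lincomb (fun j => g (gen c.+1 j) : zmodule_of abH) (expo x).
Proof.
have gM : monoid_morphism (g : N -> mul_of (zmodule_of abH)).
  by split; [apply: (gmulf1 (s := g)) | apply: (gmulfM (s := g))].
pose g' : hom N (mul_of (zmodule_of abH)) :=
  HB.pack (g : N -> mul_of (zmodule_of abH)) (isUMagmaMorphism.Build _ _ _ gM).
exact: (hom_expo g').
Qed.

Lemma expo_inj_derived (x y : N) : expo x = expo y -> derived N (x^-1 * y).
Proof.
move=> exy; apply/(coset_eq (derived_normal N)).
pose p : hom N (abelianization N) := coset (derived_normal N).
have pE := hom_abelian (@abelianization_commute N) p.
by move: (pE x) (pE y) => /= -> ->; rewrite exy.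
Qed.

End HomKernel.

(** * The abelianization of a presented group *)

Section Relators.
Variables (c n m : nat) (r : 'I_m -> word 'I_n).
Local Notation N := (free_nilpotent c.+1 'I_n).
Local Notation G := (nilpotent_presentation c.+1 r).
Local Notation M := (relation_matrix r).

Definition presentation_map : hom N G :=
  coset (normal_closure_normal (relators (c := c.+1) r)).

Lemma presentation_map_surj y : exists x, presentation_map x = y.
Proof. by have [x ->] := coset_surj y; exists x. Qed.

Lemma presentation_map_relator i : presentation_map (word_class c.+1 (r i)) = 1.
Proof. by apply/coset_eq1; apply: sub_gen_smallest; exists i. Qed.

Lemma row_relation_matrix i : row i M = exponents (r i).
Proof. by apply/rowP => j; rewrite !mxE. Qed.

Definition relation_lattice : set (mul_of 'rV[int]_n) :=
  [set v | exists t : 'rV[int]_m, v = (t *m M)%R].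

Lemma relation_lattice_normal : normal_subgroup relation_lattice.
Proof.
split=> [|x y Lx]; last by rewrite conjgE mul_of_commute mulgK.
apply/subgroupP; split; first by exists 0%R; rewrite mul0mx.
by move=> _ _ [t ->] [u ->]; exists (t - u)%R; rewrite mulmxBl.
Qed.

Lemma presentation_lift (H : groupType) (f : hom N H) :
  (forall i, f (word_class c.+1 (r i)) = 1) ->
  exists g : hom G H, forall x, g (presentation_map x) = f x.
Proof.
move=> fr; have kf x : normal_closure (relators (c := c.+1) r) x -> f x = 1.
  by move=> Rx; apply: (Rx [set x | f x = 1]); split;
    [apply: kernel_normal | move=> _ [i _ <-]; apply: fr].
by exists (quotient_lift kf) => x; apply: (quotient_liftE kf).
Qed.

(** The vectors modulo the relation lattice form an abelian quotient of [G], so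
    that exponent vectors of elements of [G'] lie in the lattice; conversely,
    the image of a vector in [G/G'] depends linearly on it, and the rows of [M]
    map to the images of the relators. *)
Lemma derived_relation_lattice x :
  derived G (presentation_map x) <-> relation_lattice (expo x).
Proof.
split=> [Dx|[t et]].
  pose q : hom _ (quotient relation_lattice_normal) :=
    coset relation_lattice_normal.
  have [i|h hE] := presentation_lift (f := q \o expo).
    apply/(coset_eq1 relation_lattice_normal); exists (delta_mx ord0 i).
    by rewrite -rowE row_relation_matrix expo_word.
  have qC (u v : quotient relation_lattice_normal) : commute u v.
    have [[{}u ->] [{}v ->]] := (coset_surj u, coset_surj v).
    by rewrite /commute -!gmulfM mul_of_commute.
  apply/(coset_eq1 relation_lattice_normal); have /= <- := hE x.
  by apply: (abelian_derived qC); apply: (gamma_hom h (k := 1)).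
pose q : hom N (abelianization G) :=
  coset (derived_normal G) \o presentation_map.
have qE := hom_abelian (@abelianization_commute G) q.
apply/(coset_eq1 (derived_normal G)); have /= -> := qE x.
rewrite et lincomb_mul big1 // => i _.
rewrite row_relation_matrix -(expo_word c) -qE /= presentation_map_relator.
rewrite gmulf1.
exact: (@mul0rz (zmodule_of (@abelianization_commute G))).
Qed.

End Relators.

(** * Saturated integer lattices *)

Section IntegerMatrices.
Import GRing.Theory.
Local Open Scope ring_scope.

Definition saturated m n (M : 'M[int]_(m, n)) : Prop :=
  forall (v : 'rV_n) k, (0 < k)%N ->
    (exists t : 'rV_m, v *+ k = t *m M) -> exists t : 'rV_m, v = t *m M.

Local Notation toQ := (map_mx (intr : int -> rat)).

Lemma toQ_inj m n : injective (toQ : 'M_(m, n) -> 'M_(m, n)).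
Proof.
move=> A B /matrixP AB; apply/matrixP => i j; have := AB i j.
by rewrite !mxE => /intr_inj.
Qed.

Definition diag_rect m n (d : seq int) : 'M[int]_(m, n) :=
  \matrix_(i, j) (d`_i *+ (i == j :> nat)).

(** Since each entry divides the next, a zero entry at [i] would leave only
    zeros after it, and the rank would be at most [i]. *)
Lemma diag_rect_neq0 m n (d : seq int) (L : 'M_m) (R : 'M_n) i :
    sorted dvdz d -> \rank (toQ (L *m diag_rect m n d *m R)) = minn m n ->
  (i < minn m n)%N -> d`_i != 0.
Proof.
move=> d_sorted rkM lti; apply/eqP => di0.
have d0 k : (i <= k)%N -> d`_k = 0.
  move=> leik; case: (ltnP k (size d)) => [ltk|/(nth_default 0)//].
  have := sorted_leq_nth dvdz_trans dvdzz 0 d_sorted i k.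
  by rewrite !inE di0 dvd0z (leq_ltn_trans leik) // => /(_ isT ltk leik)/eqP.
have Drk : (\rank (toQ (diag_rect m n d)) <= i)%N.
  have -> : toQ (diag_rect m n d) =
      diag_mx (\row_k (d`_k)%:~R) *m (pid_mx i : 'M_(m, n)).
    apply/matrixP => a b; rewrite mul_diag_mx !mxE.
    case: ltnP => [lta|/d0->]; last by rewrite mul0rn mul0r.
    by rewrite andbT mulr_natr rmorphMn.
  apply: leq_trans (mxrankM_maxr _ _) _.
  rewrite rank_pid_mx //; move: lti; rewrite leq_min => /andP[] *; exact: ltnW.
move: lti; rewrite -rkM !map_mxM ltnNge => /negP[].
by apply: leq_trans Drk; apply: leq_trans (mxrankM_maxl _ _) (mxrankM_maxr _ _).
Qed.

(** In the Smith normal form [L *m D *m R] of [M], the [j]-th row of [R] times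
    the [j]-th diagonal entry of [D] is in the row lattice of [M]; this entry is
    nonzero, and saturation removes it. *)
Lemma saturated_smith m n (M : 'M[int]_(m, n)) :
    saturated M -> \rank (toQ M) = minn m n ->
  exists L R d, [/\ R \in unitmx, M = L *m diag_rect m n d *m R &
    forall j : 'I_n, (j < m)%N -> exists t : 'rV_m, row j R = t *m M].
Proof.
move=> satM rkM.
have [L uL [R uR [d d_sorted defM]]] := int_Smith_normal_form M.
exists L, R, d; split=> // j ltjm.
have dj : d`_j != 0.
  apply: (diag_rect_neq0 (L := L) (R := R) d_sorted); rewrite /diag_rect.
    by rewrite -defM.
  by rewrite leq_min ltjm ltn_ord.
have rowD : d`_j *: row j R = row (Ordinal ltjm) (invmx L) *m M.
  rewrite -row_mul defM -mulmxA mulKmx // row_mul; apply/rowP => k.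
  rewrite !mxE (bigD1 j) //= !mxE eqxx big1 ?addr0 // => l lj.
  by rewrite !mxE /= eq_sym val_eqE (negPf lj) mulr0n mul0r.
(* The multiple is the absolute value because saturation is about natural
   multiples; the sign is moved into the coefficients. *)
apply: (satM (row j R) (absz d`_j)); first by rewrite absz_gt0.
exists (sgz d`_j *: row (Ordinal ltjm) (invmx L)).
rewrite -scalemxAl -rowD scalerA -scaler_nat.
by congr (_ *: _); rewrite natz abszEsg.
Qed.

Lemma saturated_full m n (M : 'M[int]_(m, n)) :
    saturated M -> \rank (toQ M) = minn m n -> (n <= m)%N ->
  forall v : 'rV_n, exists t : 'rV_m, v = t *m M.
Proof.
move=> satM rkM lenm v.
have [L [R [d [uR _ rowR]]]] := saturated_smith satM rkM.
have [T defT] := fin_all_exists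
  (fun j : 'I_n => rowR j (leq_trans (ltn_ord j) lenm)).
exists (v *m invmx R *m \matrix_j T j); rewrite -mulmxA.
suff -> : \matrix_j T j *m M = R by rewrite mulmxKV.
by apply/row_matrixP => j; rewrite row_mul rowK -defT.
Qed.

(** The completion consists of the last rows of the right Smith factor [R].  The
    first rows of [R] and the rows of [M] span the same lattice, so that the
    square matrix relating the two families is invertible. *)
Lemma saturated_unimodular m p (M : 'M[int]_(m, m + p)) :
    saturated M -> \rank (toQ M) = minn m (m + p) ->
  exists B B' : 'M_(m + p), usubmx B = M /\ B *m B' = 1%:M.
Proof.
move=> satM rkM; have [L [R [d [uR defM rowR]]]] := saturated_smith satM rkM.
have [T defT] := fin_all_exists (fun j : 'I_m => rowR (lshift p j) (ltn_ord j)).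
pose T' := \matrix_j T j.
have defR : usubmx R = T' *m M.
  apply/row_matrixP => j; rewrite row_mul rowK -defT.
  by apply/rowP => k; rewrite !mxE.
pose D := diag_rect m m d.
have defMD : M = L *m D *m usubmx R.
  rewrite {1}defM -!mulmxA; congr (_ *m _).
  rewrite -{1}(vsubmxK R) -[D *m _]addr0 -(mul0mx _ (dsubmx R)) -mul_row_col.
  congr (_ *m _); apply/matrixP => i j; rewrite !mxE.
  by case: splitP => k kj; rewrite !mxE kj // ltn_eqF // ltn_addr.
(* [M] is row free, so it can be cancelled in [M = (L *m D *m T') *m M]. *)
have LDT : L *m D *m T' = 1%:M.
  apply: toQ_inj; apply: (row_free_inj (A := toQ M)).
    by rewrite /row_free rkM; apply/eqP/minn_idPl/leq_addr.
  by rewrite -!map_mxM -mulmxA -defR -defMD mul1mx.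
exists (col_mx M (dsubmx R)), (invmx R *m block_mx T' 0 0 1%:M).
split; first by rewrite col_mxKu.
have -> : col_mx M (dsubmx R) = block_mx (L *m D) 0 0 1%:M *m R.
  by rewrite -{2}(vsubmxK R) mul_block_col !mul0mx addr0 add0r mul1mx -defMD.
rewrite mulmxA mulmxK // mulmx_block !(mul0mx, mulmx0, mul1mx, addr0, add0r).
by rewrite LDT -scalar_mx_block.
Qed.

End IntegerMatrices.

(** * Presented groups with torsion-free abelianization *)

(** If [v *+ k] is in the lattice and [x] has exponent vector [v], then [x ^+ k]
    becomes trivial in the abelianization, so the image of [x] there is a torsion
    element. *)
Lemma saturated_relations c n m (r : 'I_m -> word 'I_n) :
  torsion (abelianization (nilpotent_presentation c.+1 r)) = [set 1] ->
  saturated (relation_matrix r).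
Proof.
set G := nilpotent_presentation c.+1 r => torG v k k_gt0 Lvk.
have [x defv] := expo_surj c v.
suff: relation_lattice r (expo x) by rewrite defv.
apply/derived_relation_lattice/(coset_eq1 (derived_normal G)).
rewrite -[_ = 1]/([set 1] _) -torG; exists k => //.
rewrite -!gmulfXn; apply/(coset_eq1 (derived_normal G)).
apply/derived_relation_lattice; rewrite gmulfXn defv.
by rewrite mul_ofX.
Qed.

(** The exponent vectors of [f (g x)] and [x] coincide, so [f \o g] is the
    identity modulo the derived subgroup. *)
Lemma hom_mod_derived_bij c n (B C : 'M[int]_n)
    (f g : hom (free_nilpotent c.+1 'I_n) (free_nilpotent c.+1 'I_n)) :
    (forall j, expo (f (gen c.+1 j)) = row j B) ->
    (forall j, expo (g (gen c.+1 j)) = row j C) -> (C *m B = 1%:M)%R ->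
  injective (f \o g) /\ forall x, exists u, (f \o g) u = x.
Proof.
move=> fB gC CB; apply: bij_mod_derived => [|x].
  exact: free_nilpotent_gamma.
apply: expo_inj_derived.
have expoE (h : hom (free_nilpotent c.+1 'I_n) (free_nilpotent c.+1 'I_n)) D :
    (forall j, expo (h (gen c.+1 j)) = row j D) ->
    forall w, (expo (h w) = expo w *m D)%R.
  move=> hD w; have /= -> := hom_expo (expo \o h) w.
  rewrite /lincomb mulmx_sum_row; apply: eq_bigr => j _ /=.
  by rewrite hD -[in RHS](intz (expo w _ _)) scaler_int.
by rewrite /= (expoE f B) // (expoE g C) // -mulmxA CB mulmx1.
Qed.

(** Let [f] be an automorphism of [N] that maps the first [m] generators to the
    relators, [pi] the projection of [N] killing these generators and [io] its
    section.  Then the composite of [pi] with the inverse of [f] kills the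
    relators, and the induced map on [G] is inverse to
    [presentation_map c r \o f \o io]. *)
Lemma presentation_free c m p (r : 'I_m -> word 'I_(m + p)) :
    saturated (relation_matrix r) -> full_rank r ->
  isomorphic (nilpotent_presentation c.+1 r) (free_nilpotent c.+1 'I_p).
Proof.
move=> satM rkM; have [B [C [BM BC]]] := saturated_unimodular satM rkM.
set N := free_nilpotent c.+1 'I_(m + p); set P := free_nilpotent c.+1 'I_p.
set G := nilpotent_presentation c.+1 r.
have [s sB] := fin_all_exists (fun j : 'I_(m + p) => expo_surj c (row j B)).
have [z zC] := fin_all_exists (fun j : 'I_(m + p) => expo_surj c (row j C)).
pose y (j : 'I_(m + p)) : N :=
  match split j with inl i => word_class c.+1 (r i) | inr _ => s j end.
have yB j : expo (y j) = row j B.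
  rewrite /y; case: splitP => [i ij|//].
  have -> : j = lshift p i by apply/val_inj.
  by rewrite expo_word -row_relation_matrix -BM; apply/rowP => k; rewrite !mxE.
have nilN (A : choiceType) := @free_nilpotent_gamma A c.+1.
have [f fy] := free_nilpotent_lift y (nilN 'I_(m + p)).
have [g gz] := free_nilpotent_lift z (nilN 'I_(m + p)).
have fB j : expo (f (gen c.+1 j)) = row j B by rewrite fy.
have gC j : expo (g (gen c.+1 j)) = row j C by rewrite gz.
have [_ fg_surj] := hom_mod_derived_bij fB gC (mulmx1C BC).
have [gf_inj _] := hom_mod_derived_bij gC fB BC.
have f_inj : injective f by move=> u v fuv; apply: gf_inj; rewrite /= fuv.
have f_surj x : exists u, f u = x by have [u <-] := fg_surj x; exists (g u).
have [f' f'E] := choice f_surj.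
have f'K : cancel f f' by move=> x; apply: f_inj; rewrite f'E.
have f'M : monoid_morphism f'.
  by split=> [|u v]; apply: f_inj; rewrite ?gmulfM !f'E ?gmulf1.
pose f'h : hom N N := HB.pack f' (isUMagmaMorphism.Build _ _ _ f'M).
pose yP (j : 'I_(m + p)) : P :=
  match split j with inl _ => 1 | inr k => gen c.+1 k end.
have [pi piE] := free_nilpotent_lift yP (nilN 'I_p).
have [io ioE] := free_nilpotent_lift
  (fun k : 'I_p => gen c.+1 (rshift m k)) (nilN 'I_(m + p)).
have rf i : word_class c.+1 (r i) = f (gen c.+1 (lshift p i)).
  by rewrite fy /y -[lshift p i]/(unsplit (inl i)) unsplitK.
have piL i : pi (gen c.+1 (lshift p i)) = 1.
  by rewrite piE /yP -[lshift p i]/(unsplit (inl i)) unsplitK.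
have piR k : pi (gen c.+1 (rshift m k)) = gen c.+1 k.
  by rewrite piE /yP -[rshift m k]/(unsplit (inr k)) unsplitK.
have [i|h hE] := presentation_lift (r := r) (f := pi \o f'h).
  by rewrite /= rf f'K piL.
have hf w : h (presentation_map c r (f w)) = pi w by rewrite hE /= f'K.
pose k : hom P G := presentation_map c r \o f \o io.
have hk : cancel k h.
  apply: (free_nilpotent_ext (g := h \o k) (h := idfun)) => j.
  by rewrite /= ioE hf piR.
have kh : cancel h k.
  have kpi : k \o pi =1 presentation_map c r \o f.
    apply: free_nilpotent_ext => j; rewrite -(splitK j).
    case: (split j) => i /=; last by rewrite piR ioE.
    by rewrite piL !gmulf1 -rf presentation_map_relator.
  move=> u; have [x <-] := presentation_map_surj u; have [w <-] := f_surj x.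
  by rewrite hf; apply: kpi.
by exists h, k.
Qed.

(** The multiplicative map in [isomorphic] preserves the unit because groups
    cancel; its inverse is therefore available as a unital morphism. *)
Lemma isomorphic_sym (G H : groupType) :
  isomorphic G H -> exists f : hom H G, bijective f.
Proof.
move=> [f [f' fK f'K]].
have f'M : monoid_morphism f'.
  have fM1 : f 1 = 1 by apply: (mulIg (f 1)); rewrite -gmulfM !mul1g.
  split=> [|u v]; first by rewrite -fM1 fK.
  by apply: (can_inj fK); rewrite gmulfM !f'K.
pose g : hom H G := HB.pack f' (isUMagmaMorphism.Build _ _ _ f'M).
by exists g, f.
Qed.

Lemma free_nilpotent_generated c n :
  generated (range (@gen 'I_n c)) = [set: free_nilpotent c 'I_n].
Proof.
apply/seteqP; split=> // x _; have [w ->] := word_class_surj x.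
have sG := generated_subgroup (range (@gen 'I_n c)).
have /= -> := hom_word_class (idfun : hom (free_nilpotent c 'I_n) _) w.
rewrite /word_eval; elim/big_ind: _ => [|u v|[j b] _] /=.
- exact: subgroup1.
- exact: subgroupM.
- have Gj : generated (range (@gen 'I_n c)) (gen c j).
    by apply: sub_gen_smallest; exists j.
  by case: b => //; apply: (subgroupV sG).
Qed.

(** The powers of the generator are distinct because their exponents are. *)
Lemma infinite_cyclic_free c : infinite_cyclic (free_nilpotent c.+1 'I_1).
Proof.
have genX k : expo (gen c.+1 (ord0 : 'I_1) ^+ k) = (delta_mx ord0 ord0 *+ k)%R.
  by rewrite gmulfXn mul_ofX expo_gen.
split.
  pose f k := gen c.+1 (ord0 : 'I_1) ^+ k.
  have f_inj : injective f.
    move=> i j fij; have : expo (f i) = expo (f j) by rewrite fij.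
    rewrite !genX => /rowP/(_ ord0); rewrite !mulmxnE !mxE /=.
    by rewrite !natz => -[].
  move=> /(finite_preimage (in2W f_inj)); exact: infinite_nat.
exists (gen c.+1 ord0); rewrite -free_nilpotent_generated; congr generated.
apply/seteqP; split=> [_ ->|_ [j _ <-]]; first by exists ord0.
by rewrite (ord1 j).
Qed.

Lemma infinite_cyclic_isomorphic (G H : groupType) :
  isomorphic G H -> infinite_cyclic H -> infinite_cyclic G.
Proof.
move=> /isomorphic_sym[f [f' fK f'K]] [infH [g gH]]; split.
  move=> finG; apply: infH; rewrite -(_ : f' @` setT = setT).
    exact: finite_image.
  by apply/seteqP; split=> // x _; exists (f x).
exists (f g); apply/seteqP; split=> // x _.
suff: [set: H] `<=` f @^-1` generated [set f g].
  by move/(_ (f' x) I); rewrite /= f'K.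
rewrite -gH; apply: generated_sub => [|_ ->].
  exact/subgroup_preimage/generated_subgroup.
exact: sub_gen_smallest.
Qed.

Theorem proposition4p4 (c n m : nat) (r : 'I_m -> word 'I_n) :
  (2 <= c)%N ->
  full_rank r ->
  torsion (abelianization (nilpotent_presentation c r)) = [set 1%g]%classic ->
  [/\ (n <= m)%N -> trivial_group (nilpotent_presentation c r),
      (m + 1)%N = n -> infinite_cyclic (nilpotent_presentation c r) &
      (m + 2 <= n)%N ->
        is_free_nilpotent c (n - m)%N (nilpotent_presentation c r)].
Proof.
case: c => // c _ rkM /saturated_relations satM; split=> [lenm|nE|lemn].
- have nilG : gamma (nilpotent_presentation c.+1 r) c.+2 `<=` [set 1].
    have surj := @presentation_map_surj c n m r.
    move=> y /(gamma_surj (f := presentation_map c r) surj)[x Nx <-].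
    by rewrite (free_nilpotent_gamma Nx) gmulf1.
  apply: (perfect_nilpotent nilG); apply/seteqP; split=> // y _.
  have [x <-] := presentation_map_surj y; apply/derived_relation_lattice.
  exact: (saturated_full satM rkM).
- subst n; apply: infinite_cyclic_isomorphic.
    exact: presentation_free satM rkM.
  exact: infinite_cyclic_free.
have [p nE] : exists p, n = (m + p)%N.
  by exists (n - m)%N; rewrite subnKC // (leq_trans (leq_addr 2 m)).
by subst n; rewrite addKn; apply: presentation_free.
Qed.
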